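(* Let $ABC$ be a nondegenerate triangle without right angle, with $a=|BC|$, $b=|CA|$, $c=|AB|$ and circumradius $R$. Let $DEF$ be the triangle formed by the tangents to the circumcircle of $ABC$ at $A,B,C$, where $D$ is the intersection of the tangents at $B$ and $C$, $E$ that of the tangents at $C$ and $A$, and $F$ that of the tangents at $A$ and $B$. Let $|EF|,|FD|,|DE|$ denote the signed side lengths $$|EF|=\frac{a^3bc}{2S_BS_C},\qquad |FD|=\frac{ab^3c}{2S_AS_C},\qquad |DE|=\frac{abc^3}{2S_AS_B}.$$ Let $x,y,z$ be real numbers such that $\mu=\frac{x}{|EF|}+\frac{y}{|FD|}+\frac{z}{|DE|}\neq0$, and let $$P=\mu^{-1}\left(\frac{y}{|FD|}D+\frac{z}{|DE|}E+\frac{x}{|EF|}F\right),\qquad Q=\mu^{-1}\left(\frac{z}{|DE|}D+\frac{x}{|EF|}E+\frac{y}{|FD|}F\right).$$ Then $$R^2(x+y+z)^2-\left(yza^2+zxb^2+xyc^2\right)=\mu^2R^2|PQ|^2\ \ge\ 0 .$$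
   Context: Conway notation: $S_A=\frac12(b^2+c^2-a^2)$, $S_B=\frac12(c^2+a^2-b^2)$, $S_C=\frac12(a^2+b^2-c^2)$. When $ABC$ is acute the quantities $|EF|,|FD|,|DE|$ are the ordinary side lengths of $DEF$; when $ABC$ is obtuse some of them are negative, as given by the formulas. $P$ and $Q$ are affine combinations of $D,E,F$ (weights summing to $1$), and $|PQ|$ is the ordinary distance. *)

(* Defs.v *)
From mathcomp Require Import all_boot all_order all_algebra.

Set Implicit Arguments.
Unset Strict Implicit.
Unset Printing Implicit Defensive.

Import Order.TTheory GRing.Theory Num.Theory.
Local Open Scope ring_scope.

Section Plane.
Variable R : rcfType.
Implicit Types (A B C O T X Y u v : 'rV[R]_2) (r : R).

Definition dot u v : R := (u *m v^T) 0 0.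

Definition dist X Y : R := Num.sqrt (dot (X - Y) (X - Y)).

Definition nondegenerate_triangle A B C : bool := row_free (col_mx (B - A) (C - A)).

(* The angle at the middle vertex A. *)
Definition right_angle B A C : bool := dot (B - A) (C - A) == 0.

Definition on_circle O r X : Prop := dist O X = r.

Definition circumcircle O r A B C : Prop :=
  [/\ on_circle O r A, on_circle O r B & on_circle O r C].

Definition on_line T v X : Prop := exists t : R, X = T + t *: v.

(* X lies on a line (direction v) that meets the circle at T and only there. *)
Definition on_tangent O r T X : Prop :=
  exists v, [/\ v != 0,
    forall Y, on_line T v Y /\ on_circle O r Y <-> Y = T
    & on_line T v X].

(* S_A = conway a b c, S_B = conway b c a, S_C = conway c a b. *)
Definition conway (a b c : R) : R := (b ^+ 2 + c ^+ 2 - a ^+ 2) / 2.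

End Plane.

(* Main.v *)
Require Import Defs.
From mathcomp Require Import all_boot all_order all_algebra.
From mathcomp Require Import ring.

Set Implicit Arguments.
Unset Strict Implicit.
Unset Printing Implicit Defensive.

Import Order.TTheory GRing.Theory Num.Theory.
Local Open Scope ring_scope.

(** By inscribed angles the signed vectors EF, FD, DE are the common multiple
    k = +-1/R, times the signed side lengths, of the radii OA, OB, OC rotated by
    a quarter turn.  Hence mu PQ is k times the rotated vector
    x OA + y OB + z OC, whose squared length expands to the left-hand side
    because 2 OA.OB = 2 R^2 - c^2, and cyclically. *)

Section PlaneGeometry.
Variable K : rcfType.
Implicit Types (A B C O T X D E F u v w : 'rV[K]_2) (R r : K).

Definition cross u v : K := u 0 0 * v 0 1 - u 0 1 * v 0 0.

(** Clockwise quarter turn, a linear map that preserves lengths. *)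
Definition perp u : 'rV[K]_2 := \row_j (if j == 0 then u 0 1 else - u 0 0).

Lemma dotE u v : dot u v = u 0 0 * v 0 0 + u 0 1 * v 0 1.
Proof.
rewrite /dot mxE big_ord_recl big_ord1 !mxE.
by rewrite (_ : lift ord0 ord0 = 1) //; apply/val_inj.
Qed.

Lemma row2P u v : u 0 0 = v 0 0 -> u 0 1 = v 0 1 -> u = v.
Proof.
move=> e0 e1; apply/rowP=> j; case: (unliftP 0 j) => [k|] -> //.
by rewrite (ord1 k) (_ : lift 0 0 = 1) //; apply/val_inj.
Qed.

Lemma perpE u : (perp u 0 0 = u 0 1) * (perp u 0 1 = - u 0 0).
Proof. by rewrite !mxE. Qed.

Lemma dot_ge0 u : 0 <= dot u u.
Proof. by rewrite dotE addr_ge0 // -expr2 sqr_ge0. Qed.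

Lemma dot_eq0 u : (dot u u == 0) = (u == 0).
Proof.
apply/idP/eqP => [|->]; last by rewrite dotE !mxE !mul0r addr0.
rewrite dotE -!expr2 paddr_eq0 ?sqr_ge0 // !sqrf_eq0 => /andP[/eqP u0 /eqP u1].
by apply: row2P; rewrite !mxE.
Qed.

Lemma sqr_dist A B : dist A B ^+ 2 = dot (B - A) (B - A).
Proof. by rewrite /dist sqr_sqrtr ?dot_ge0 // !dotE !mxE; ring. Qed.

(** Law of cosines: the Conway quantity at A is bc cos A, so it vanishes exactly when the angle
    there is right. *)
Lemma conway_dot A B C :
  conway (dist B C) (dist C A) (dist A B) = dot (B - A) (C - A).
Proof.
by rewrite /conway !sqr_dist !dotE !mxE; field.
Qed.

Lemma nondegenerate_cross A B C :
  nondegenerate_triangle A B C -> cross (B - A) (C - A) != 0.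
Proof.
(* The stacked matrix has height 1 + 1; retyping it as 2 by 2 gives access to the determinant. *)
rewrite /nondegenerate_triangle -[row_free _]/(@row_free _ 2 2 _).
rewrite row_free_unit unitmxE unitfE; set M := col_mx _ _.
have e0 j : M 0 j = (B - A) 0 j.
  rewrite -(col_mxEu (B - A) (C - A)); congr (M _ j); exact/val_inj.
have e1 j : M 1 j = (C - A) 0 j.
  rewrite -(col_mxEd (B - A) (C - A)); congr (M _ j); exact/val_inj.
have l0 : lift 0 0 = 1 :> 'I_2 by apply/val_inj.
have l1 : lift 1 0 = 0 :> 'I_2 by apply/val_inj.
move: M e0 e1 => M e0 e1; suff -> : \det M = cross (B - A) (C - A) by [].
rewrite (expand_det_row _ 0) big_ord_recl big_ord1 /cofactor !det_mx11 !mxE !l0 !l1.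
rewrite !e0 !e1 /cross /=; ring.
Qed.

(* Otherwise the line would meet the circle again at the reflection of T in
   the foot of the perpendicular from O. *)
Lemma on_tangent_dot O R T X : on_tangent O R T X -> dot (T - O) (X - T) = 0.
Proof.
move=> [v [v0 vP [t ->]]].
have vv0 : dot v v != 0 by rewrite dot_eq0.
set k := - (2 * dot (T - O) v / dot v v).
have [_ OT] := (vP T).2 erefl.
have : T + k *: v = T.
  apply: (vP _).1; split; first by exists k.
  rewrite -OT /on_circle /dist; congr Num.sqrt.
  by move: vv0; rewrite /k !dotE !mxE => vv0; field.
move=> /(canRL (addKr _)); rewrite addNr => /eqP.
rewrite scaler_eq0 (negPf v0) orbF oppr_eq0 mulf_eq0 invr_eq0 (negPf vv0) orbF.
rewrite mulf_eq0 pnatr_eq0 /= => /eqP Tv.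
transitivity (t * dot (T - O) v); last by rewrite Tv mulr0.
by rewrite !dotE !mxE; ring.
Qed.

(** Equal distances from O fix the inner products of A - O with B - A and C - A; Cramer's rule then
    solves for A - O. With this formula, identities about O become rational identities in the
    coordinates of A, B, C. *)
Lemma circumcenterE A B C O :
  cross (B - A) (C - A) != 0 ->
  dot (A - O) (A - O) = dot (B - O) (B - O) ->
  dot (A - O) (A - O) = dot (C - O) (C - O) ->
  A - O = (2 * cross (B - A) (C - A))^-1 *:
    perp (dot (B - A) (B - A) *: (A - C) + dot (C - A) (C - A) *: (B - A)).
Proof.
set d := cross _ _ => d0 eB eC.
have dK : 2 * d != 0 by rewrite mulf_neq0 ?pnatr_eq0.
apply: (scalerI dK); rewrite scalerA divff // scale1r.
have eB' : dot (B - A) (B - A) = - (2 * dot (A - O) (B - A)).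
  move: eB => /eqP; rewrite -subr_eq0 => /eqP eB.
  by rewrite -[LHS]addr0 -eB !dotE !mxE; ring.
have eC' : dot (C - A) (C - A) = - (2 * dot (A - O) (C - A)).
  move: eC => /eqP; rewrite -subr_eq0 => /eqP eC.
  by rewrite -[LHS]addr0 -eC !dotE !mxE; ring.
by rewrite eB' eC' /d /cross !dotE; apply: row2P; rewrite !mxE /=; ring.
Qed.

Section Circumcircle.
Variables A B C O : 'rV[K]_2.
Hypothesis nondegenerate : cross (B - A) (C - A) != 0.
Hypothesis OB : dot (A - O) (A - O) = dot (B - O) (B - O).
Hypothesis OC : dot (A - O) (A - O) = dot (C - O) (C - O).

Let center := circumcenterE nondegenerate OB OC.

(** The square of abc = 4 R area, as [cross] is twice the signed area. *)
Lemma circumradius_cross :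
  4 * cross (B - A) (C - A) ^+ 2 * dot (A - O) (A - O)
  = dot (C - B) (C - B) * dot (A - C) (A - C) * dot (B - A) (B - A).
Proof.
rewrite center; move: nondegenerate; rewrite /cross !dotE !mxE /= => d0.
by field.
Qed.

(* In terms of angles: [R^2 sin 2A = 2 R^2 sin A cos A]. *)
Lemma circumcenter_cross :
  2 * dot (A - O) (A - O) * dot (B - A) (C - A) * cross (B - A) (C - A)
  = dot (A - C) (A - C) * dot (B - A) (B - A) * cross (B - O) (C - O).
Proof.
rewrite -[B - O](subrKA A) -[C - O](subrKA A) center.
move: nondegenerate; rewrite !dotE /cross !mxE /= => d0.
by field.
Qed.

(* The barycentric coordinates of the circumcenter are [a^2 S_A : b^2 S_B : c^2 S_C]. *)
Lemma circumcenter_barycentric :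
  (dot (A - C) (A - C) * dot (C - B) (A - B)) *: (B - A)
    + (dot (B - A) (B - A) * dot (A - C) (B - C)) *: (C - A)
  = - (2 * cross (B - A) (C - A) ^+ 2) *: (A - O).
Proof.
rewrite center; move: nondegenerate; rewrite !dotE /cross !mxE => d0.
by apply: row2P; rewrite !mxE /=; field.
Qed.

Lemma circumradius_neq0 : dot (A - O) (A - O) != 0.
Proof.
apply: contra nondegenerate => AO.
move: (AO) (AO); rewrite {1}OB !dot_eq0 !subr_eq0 => /eqP -> /eqP ->.
by rewrite /cross !mxE; apply/eqP; ring.
Qed.

End Circumcircle.

(** Lets one signed area serve all three cyclic relabellings of the triangle. *)
Lemma cross_cycle A B C : cross (C - B) (A - B) = cross (B - A) (C - A).
Proof. by rewrite /cross !mxE; ring. Qed.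

(** D is the pole of line BC: tangency says that D - O has inner product equal to the squared radius
    with both B - O and C - O. [circumcenter_cross] then trades the cross product of these radii for
    the Conway quantity at A. *)
Lemma tangent_intersection A B C O D :
  cross (B - A) (C - A) != 0 ->
  dot (A - O) (A - O) = dot (B - O) (B - O) ->
  dot (A - O) (A - O) = dot (C - O) (C - O) ->
  dot (B - O) (D - B) = 0 -> dot (C - O) (D - C) = 0 ->
  (2 * dot (B - A) (C - A) * cross (B - A) (C - A)) *: (D - O)
  = (dot (A - C) (A - C) * dot (B - A) (B - A)) *: perp (C - B).
Proof.
move=> d0 OB OC BD CD.
have r0 := circumradius_neq0 d0 OB.
have polar : cross (B - O) (C - O) *: (D - O)
    = dot (A - O) (A - O) *: perp (C - B).
  have eB : dot (B - O) (D - O) = dot (A - O) (A - O).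
    by rewrite OB -[RHS]addr0 -BD !dotE !mxE; ring.
  have eC : dot (C - O) (D - O) = dot (A - O) (A - O).
    by rewrite OC -[RHS]addr0 -CD !dotE !mxE; ring.
  (* Planar expansion of a vector w by its inner products: [cross u v *: w = perp (dot u w *: v -
     dot v w *: u)]. *)
  transitivity (perp (dot (B - O) (D - O) *: (C - O)
                      - dot (C - O) (D - O) *: (B - O))).
    by apply: row2P; rewrite !perpE !dotE /cross !mxE; ring.
  by rewrite eB eC; apply: row2P; rewrite !mxE /=; ring.
apply: (scalerI r0); rewrite !scalerA.
rewrite [dot (A - O) _ * (dot _ _ * _)]mulrC -!scalerA -polar !scalerA.
by rewrite -circumcenter_cross //; congr (_ *: _); ring.
Qed.

(** Vector form of the signed length of EF. Once denominators are cleared, F - E is a rotated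
    combination of B - A and C - A with the barycentric weights of O, hence a multiple of the
    rotated radius at A. *)
Lemma tangential_side A B C O E F :
  cross (B - A) (C - A) != 0 ->
  dot (A - O) (A - O) = dot (B - O) (B - O) ->
  dot (A - O) (A - O) = dot (C - O) (C - O) ->
  dot (C - O) (E - C) = 0 -> dot (A - O) (E - A) = 0 ->
  dot (A - O) (F - A) = 0 -> dot (B - O) (F - B) = 0 ->
  (dot (C - B) (A - B) * dot (A - C) (B - C)) *: (F - E)
  = - (dot (C - B) (C - B) * cross (B - A) (C - A)) *: perp (A - O).
Proof.
move=> d0 OB OC CE AE AF BF.
have dB := cross_cycle A B C; have dC := cross_cycle B C A.
(* The holes remain as premises, so the rewrites below also bring them to [d0], [OB], [OC] or a
   reflexive equality. *)
have eE : _ = _ := @tangent_intersection B C A O E _ _ _ CE AE.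
have eF : _ = _ := @tangent_intersection C A B O F _ _ _ AF BF.
rewrite dB -OB in eE; rewrite dC dB -OC in eF.
move: {eE eF} (eE d0 OC erefl) (eF d0 erefl OB).
have := circumcenter_barycentric d0 OB OC.
set d := cross _ _ in d0 *.
move=> bary eE eF.
have d2 : 2 * d != 0 by rewrite mulf_neq0 ?pnatr_eq0.
apply: (scalerI d2); rewrite scalerA.
transitivity (dot (C - B) (A - B) *: ((2 * dot (A - C) (B - C) * d) *: (F - O))
   - dot (A - C) (B - C) *: ((2 * dot (C - B) (A - B) * d) *: (E - O))).
  by apply: row2P; rewrite !mxE; ring.
rewrite eE eF.
transitivity (dot (C - B) (C - B) *: perp
  ((dot (A - C) (A - C) * dot (C - B) (A - B)) *: (B - A)
    + (dot (B - A) (B - A) * dot (A - C) (B - C)) *: (C - A))).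
  by apply: row2P; rewrite !mxE /=; ring.
by rewrite bary; apply: row2P; rewrite !mxE /=; ring.
Qed.

End PlaneGeometry.
Theorem mainTheorem6 (K : rcfType) (A B C O D E F : 'rV[K]_2) (R x y z : K)
  (ABC_nondegenerate : nondegenerate_triangle A B C)
  (A_not_right : ~~ right_angle B A C)
  (B_not_right : ~~ right_angle C B A)
  (C_not_right : ~~ right_angle A C B)
  (ABC_circumcircle : circumcircle O R A B C)
  (D_tangents : on_tangent O R B D /\ on_tangent O R C D)
  (E_tangents : on_tangent O R C E /\ on_tangent O R A E)
  (F_tangents : on_tangent O R A F /\ on_tangent O R B F) :
  let a := dist B C in
  let b := dist C A in
  let c := dist A B in
  let SA := conway a b c in
  let SB := conway b c a in
  let SC := conway c a b in
  let EF := (a ^+ 3 * b * c) / (2 * SB * SC) in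
  let FD := (a * b ^+ 3 * c) / (2 * SA * SC) in
  let DE := (a * b * c ^+ 3) / (2 * SA * SB) in
  let mu := x / EF + y / FD + z / DE in
  mu != 0 ->
  let P := mu^-1 *: ((y / FD) *: D + (z / DE) *: E + (x / EF) *: F) in
  let Q := mu^-1 *: ((z / DE) *: D + (x / EF) *: E + (y / FD) *: F) in
  R ^+ 2 * (x + y + z) ^+ 2
    - (y * z * a ^+ 2 + z * x * b ^+ 2 + x * y * c ^+ 2)
    = mu ^+ 2 * R ^+ 2 * dist P Q ^+ 2
  /\ 0 <= mu ^+ 2 * R ^+ 2 * dist P Q ^+ 2.
Proof.
move=> a b c SA SB SC EF FD DE mu mu0 P Q.
split; last by rewrite mulr_ge0 ?sqr_ge0 // mulr_ge0 ?sqr_ge0.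
have [OA OB OC] := ABC_circumcircle.
have R2 : dot (A - O) (A - O) = R ^+ 2 by rewrite -OA sqr_dist.
have AB : dot (A - O) (A - O) = dot (B - O) (B - O).
  by rewrite R2 -OB sqr_dist.
have AC : dot (A - O) (A - O) = dot (C - O) (C - O).
  by rewrite R2 -OC sqr_dist.
have [/on_tangent_dot BD /on_tangent_dot CD] := D_tangents.
have [/on_tangent_dot CE /on_tangent_dot AE] := E_tangents.
have [/on_tangent_dot AF /on_tangent_dot BF] := F_tangents.
have d0 := nondegenerate_cross ABC_nondegenerate.
have dB := cross_cycle A B C; have dC := cross_cycle B C A.
have sideA := tangential_side d0 AB AC CE AE AF BF.
have dB0 : cross (C - B) (A - B) != 0 by rewrite dB.
have sideB := tangential_side dB0 (etrans (esym AB) AC) (esym AB) AF BF BD CD.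
have dC0 : cross (A - C) (B - C) != 0 by rewrite dC.
have sideC := tangential_side dC0 (esym AC) (etrans (esym AC) AB) BD CD CE AE.
rewrite dB in sideB; rewrite dC dB in sideC.
have := circumradius_cross d0 AB AC; rewrite R2.
have := circumradius_neq0 d0 AB; rewrite R2.
move: d0 sideA sideB sideC => {dB dB0 dC dC0}.
rewrite -(conway_dot A B C) -(conway_dot B C A) -(conway_dot C A B) -!sqr_dist.
rewrite -/a -/b -/c -/SA -/SB -/SC; set d := cross _ _.
move=> d0 sideA sideB sideC R0 area.
(* The area relation makes every side nonzero, since [d] and [R] are. *)
have abc0 : a ^+ 2 * b ^+ 2 * c ^+ 2 != 0.
  by rewrite -area mulf_eq0 (negPf R0) orbF mulf_eq0 expf_eq0 (negPf d0) pnatr_eq0.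
have [a0 b0 c0] : [/\ a != 0, b != 0 & c != 0].
  by move: abc0; rewrite -!exprMn expf_eq0 /= !mulf_eq0 !negb_or => /andP[/andP[]].
have SA0 : SA != 0 by rewrite /SA conway_dot.
have SB0 : SB != 0.
  by apply: contra B_not_right; rewrite /SB conway_dot /right_angle !dotE
    mulrC [X in _ + X]mulrC.
have SC0 : SC != 0 by rewrite /SC conway_dot.
have neq0 := (a0, b0, c0, SA0, SB0, SC0).
(* The common factor 1/R up to sign; its sign is the orientation of ABC. *)
pose k := 2 * d / (a * b * c).
have eA : (x / EF) *: (F - E) = - (x * k) *: perp (A - O).
  (* Isolates the factor [SB * SC] that [sideA] absorbs. *)
  rewrite (_ : x / EF = 2 * x / (a ^+ 3 * b * c) * (SB * SC)); last first.
    by rewrite /EF; field; rewrite !neq0.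
  by rewrite -scalerA sideA scalerA; congr (_ *: _); rewrite /k; field; rewrite !neq0.
have eB : (y / FD) *: (D - F) = - (y * k) *: perp (B - O).
  rewrite (_ : y / FD = 2 * y / (a * b ^+ 3 * c) * (SC * SA)); last first.
    by rewrite /FD; field; rewrite !neq0.
  by rewrite -scalerA sideB scalerA; congr (_ *: _); rewrite /k; field; rewrite !neq0.
have eC : (z / DE) *: (E - D) = - (z * k) *: perp (C - O).
  rewrite (_ : z / DE = 2 * z / (a * b * c ^+ 3) * (SA * SB)); last first.
    by rewrite /DE; field; rewrite !neq0.
  by rewrite -scalerA sideC scalerA; congr (_ *: _); rewrite /k; field; rewrite !neq0.
have muQP : mu *: (Q - P)
    = k *: perp (x *: (A - O) + y *: (B - O) + z *: (C - O)).
  (* P and Q carry the same weights shifted cyclically, so their difference is a combination of the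
     sides of DEF. *)
  transitivity (- ((x / EF) *: (F - E) + (y / FD) *: (D - F)
                   + (z / DE) *: (E - D))).
    rewrite -scalerBr scalerA divff // scale1r.
    by apply: row2P; rewrite !mxE; ring.
  by rewrite eA eB eC; apply: row2P; rewrite !mxE /=; ring.
have k2 : k ^+ 2 * R ^+ 2 = 1.
  transitivity ((4 * d ^+ 2 * R ^+ 2) / (a ^+ 2 * b ^+ 2 * c ^+ 2)).
    by rewrite /k; field; rewrite !neq0.
  by rewrite area divff.
rewrite sqr_dist.
transitivity (R ^+ 2 * dot (mu *: (Q - P)) (mu *: (Q - P))); last first.
  by rewrite !dotE !mxE; ring.
rewrite muQP.
(* The rotation drops out of the squared length, and twice each inner product of radii is written by
   the law of cosines. *)
transitivity (k ^+ 2 * R ^+ 2 *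
    (x ^+ 2 * dot (A - O) (A - O) + y ^+ 2 * dot (B - O) (B - O)
     + z ^+ 2 * dot (C - O) (C - O)
     + y * z * (dot (B - O) (B - O) + dot (C - O) (C - O) - a ^+ 2)
     + z * x * (dot (C - O) (C - O) + dot (A - O) (A - O) - b ^+ 2)
     + x * y * (dot (A - O) (A - O) + dot (B - O) (B - O) - c ^+ 2))).
  by rewrite k2 mul1r -AC -AB R2; ring.
by rewrite /a /b /c !sqr_dist !dotE !mxE /=; ring.
Qed.
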